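(* Let $G$ be a finite graph (without loops) such that $\Delta(G)\geqslant 2$ and such that $G$ has no spanning even subgraph without isolated vertices. Then $\check s(G)>\delta(G)$.
   Context: $\Delta(G)$ and $\delta(G)$ denote the maximum and minimum degree of $G$. An edge-coloring of $G$ is a map $c\colon E(G)\to\{1,\dots,k\}$ (for some $k$) such that any two incident edges receive different colors. The palette of a vertex $v$ with respect to $c$ is $P_c(v)=\{c(e): e\in E(G) \text{ incident to } v\}$. The palette index $\check s(G)$ is the minimum, over all edge-colorings $c$ of $G$, of the number of distinct palettes $P_c(v)$, $v\in V(G)$. An even subgraph of $G$ is a subgraph in which every vertex has even degree; a spanning even subgraph is an even subgraph $K$ with $V(K)=V(G)$. ''Without isolated vertices'' means every vertex of $K$ has degree at least $1$ (equivalently, at least $2$) in $K$. *)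

(* Defs.v *)
From mathcomp Require Import all_boot.
From mathcomp Require Import boolp.

Set Implicit Arguments.
Unset Strict Implicit.
Unset Printing Implicit Defensive.

(* Finite loopless graphs in which parallel edges are allowed: an edge is an
   abstract element with exactly two (distinct) ends.  A simple graph is the
   case where [ends] is injective. *)
Record graph := Graph {
  vert : finType;
  edge : finType;
  ends : edge -> {set vert};
  card_ends : forall e : edge, #|ends e| = 2
}.

Definition degree (G : graph) (v : vert G) : nat :=
  #|[set e : edge G | v \in ends e]|.

Definition max_degree (G : graph) : nat := \max_(v : vert G) degree v.

(* Every degree is at most [#|edge G|], so the default value of the iterated
   minimum plays no role as soon as [G] has a vertex. *)
Definition min_degree (G : graph) : nat :=
  \big[minn/#|edge G|]_(v : vert G) degree v.

Definition incident (G : graph) (e f : edge G) : bool :=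
  (e != f) && (ends e :&: ends f != set0).

(* The colors 1, ..., k are represented by 'I_k. *)
Definition edge_coloring (G : graph) (k : nat) (c : edge G -> 'I_k) : Prop :=
  forall e f : edge G, incident e f -> c e <> c f.

Definition palette (G : graph) (k : nat) (c : edge G -> 'I_k) (v : vert G) :
    {set 'I_k} :=
  [set c e | e in [set e : edge G | v \in ends e]].

Definition num_palettes (G : graph) (k : nat) (c : edge G -> 'I_k) : nat :=
  #|[set palette c v | v : vert G]|.

Definition attained_num_palettes (G : graph) (s : nat) : Prop :=
  exists (k : nat) (c : edge G -> 'I_k), edge_coloring c /\ num_palettes c = s.

Lemma attained_num_palettes_nonempty (G : graph) :
  exists s : nat, `[< attained_num_palettes G s >].
Proof.
exists (num_palettes (@enum_rank (edge G))); apply/asboolP.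
exists #|edge G|, (@enum_rank (edge G)); split=> // e f /andP[/eqP nef _].
by move/enum_rank_inj.
Qed.

Definition palette_index (G : graph) : nat :=
  ex_minn (attained_num_palettes_nonempty G).

Record subgraph (G : graph) := Subgraph {
  sub_vert : {set vert G};
  sub_edge : {set edge G};
  sub_ends : forall e : edge G, e \in sub_edge -> ends e \subset sub_vert
}.

Definition sub_degree (G : graph) (K : subgraph G) (v : vert G) : nat :=
  #|[set e in sub_edge K | v \in ends e]|.

Definition spanning (G : graph) (K : subgraph G) : Prop :=
  sub_vert K = [set: vert G].

Definition even_subgraph (G : graph) (K : subgraph G) : Prop :=
  forall v : vert G, v \in sub_vert K -> ~~ odd (sub_degree K v).

Definition no_isolated_vertex (G : graph) (K : subgraph G) : Prop :=
  forall v : vert G, v \in sub_vert K -> 1 <= sub_degree K v.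

(* Main.v *)
Require Import Defs.
From mathcomp Require Import all_boot.

Set Implicit Arguments.
Unset Strict Implicit.
Unset Printing Implicit Defensive.

(** Let [F] be the set of palettes of a coloring with [#|F| <= min_degree G].
    If a set [S] of colors meets every palette in a nonzero even number of
    colors, then the edges colored in [S] form a spanning even subgraph without
    isolated vertices.  To find [S], work in the binary matroid on the colors
    whose cycles are the sets meeting every palette evenly, and let [T] be the
    complement of a base; the base has at most [#|F|] elements.  The cycle [S]
    containing [T] meets every palette not contained in the base, so it can
    only fail when the base is itself a palette and [S = T].  Then adding to [S]
    the fundamental circuit of some [t \in T] yields a cycle that works. *)

Section EvenSets.

Variable I : finType.
Implicit Types (A B C D P S T : {set I}) (F : {set {set I}}).

Definition symdiff A B : {set I} := (A :\: B) :|: (B :\: A).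

Lemma in_symdiff A B x : (x \in symdiff A B) = (x \in A) (+) (x \in B).
Proof. by rewrite !inE; case: (x \in A); case: (x \in B). Qed.

Lemma odd_card_symdiff P A B :
  odd #|P :&: symdiff A B| = odd #|P :&: A| (+) odd #|P :&: B|.
Proof.
have -> : P :&: symdiff A B = symdiff (P :&: A) (P :&: B).
  apply/setP => x; rewrite !(inE, in_symdiff).
  by case: (x \in P); case: (x \in A); case: (x \in B).
move: (P :&: A) (P :&: B) => {P} {}A {}B.
rewrite cardsU disjoint_setI0 ?cards0 ?subn0; last first.
  by apply/pred0P => x /=; rewrite !inE; case: (x \in A); case: (x \in B).
rewrite oddD -(cardsID B A) -(cardsID A B) !oddD (setIC B A).
by case: (odd #|A :&: B|); case: (odd #|A :\: B|); case: (odd #|B :\: A|).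
Qed.

Definition evenly_meets F S : bool := [forall P : {set I} in F, ~~ odd #|P :&: S|].

Lemma evenly_meetsP F S :
  reflect (forall P, P \in F -> ~~ odd #|P :&: S|) (evenly_meets F S).
Proof. exact: forall_inP. Qed.

Lemma evenly_meets_symdiff F A B :
  evenly_meets F A -> evenly_meets F B -> evenly_meets F (symdiff A B).
Proof.
move=> /evenly_meetsP hA /evenly_meetsP hB; apply/evenly_meetsP => P PF.
by rewrite odd_card_symdiff (negbTE (hA _ PF)) (negbTE (hB _ PF)).
Qed.

(** Send each subset of [B] to the family of members of [F] that it meets oddly. There are more
    subsets than possible families, so two distinct subsets collide, and their symmetric difference
    works. *)
Lemma evenly_meets_pigeonhole F B :
  #|F| < #|B| -> exists2 D : {set I}, D \subset B & (D != set0) && evenly_meets F D.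
Proof.
move=> ltFB; pose f A := [set P in F | odd #|P :&: A|].
have /dinjectivePn[X XB [Y /andP[YX YB] eqf]] : ~~ dinjectiveb f (powerset B).
  apply/negP => /dinjectiveP injf.
  have /subset_leq_card : f @: powerset B \subset powerset F.
    apply/subsetP => _ /imsetP[A _ ->]; rewrite powersetE.
    by apply/subsetP => P; rewrite inE => /andP[].
  by rewrite card_in_imset // !card_powerset leq_exp2l // leqNgt ltFB.
move: XB YB; rewrite !powersetE => /subsetP XB /subsetP YB.
exists (symdiff X Y); last (apply/andP; split).
- apply/subsetP => x; rewrite in_symdiff.
  by case: (boolP (x \in X)) => [/XB //|_ /= /YB].
- apply: contra YX => /eqP D0; apply/eqP/setP => x.
  move/setP/(_ x): D0; rewrite in_symdiff inE.
  by case: (x \in X); case: (x \in Y).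
- apply/evenly_meetsP => P PF; rewrite odd_card_symdiff.
  by move/setP/(_ P): eqf; rewrite !inE PF /= => ->; rewrite addbb.
Qed.

(* Equivalently, the complement of [T] spans the matroid of cycles
   [evenly_meets F]. *)
Definition free F T : bool :=
  [forall A : {set I}, (A \subset T) ==> [exists S : {set I}, evenly_meets F S && (S :&: T == A)]].

Lemma freeP F T :
  reflect (forall A, A \subset T -> exists2 S : {set I}, evenly_meets F S & S :&: T = A)
          (free F T).
Proof.
apply: (iffP forallP) => h A; first move=> AT.
  have /existsP[S /andP[hS /eqP]] := implyP (h A) AT; by exists S.
by apply/implyP => /h[S hS hA]; apply/existsP; exists S; rewrite hS hA eqxx.
Qed.

(** Take [T] maximal. A larger complement would contain a nonempty [D] meeting [F] evenly; adding
    [D] to a set toggles any chosen [d] in [D] and leaves the trace on [T] unchanged, so [d |: T]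
    would be free as well. *)
Lemma exists_free_cocard F : exists2 T : {set I}, free F T & #|~: T| <= #|F|.
Proof.
have free0 : free F set0.
  apply/freeP => A; rewrite subset0 => /eqP->; exists set0; last exact: setI0.
  by apply/evenly_meetsP => P _; rewrite setI0 cards0.
have [T /maxsetP[fT maxT] _] := maxset_exists (P := free F) free0.
exists T => //; rewrite leqNgt; apply/negP => /evenly_meets_pigeonhole.
case=> D /subsetP DT /andP[/set0Pn[d Dd] evD].
have dT : d \notin T by have := DT _ Dd; rewrite inE.
suff fTd : free F (d |: T).
  by move: dT; rewrite -{1}(maxT _ fTd (subsetUr _ _)) setU11.
apply/freeP => A /subsetP AT.
have [S evS hS] := freeP _ _ fT (A :&: T) (subsetIr _ _).
have memT x : x \in T -> (x \in S) = (x \in A) /\ (x \in D) = false.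
  move=> xT; split; first by move/setP/(_ x): hS; rewrite !inE xT !andbT.
  by apply/negP => /DT; rewrite inE xT.
have [eqd|neqd] := boolP ((d \in S) == (d \in A)).
- exists S => //; apply/setP => x; rewrite !inE.
  have [->|xd] := eqVneq x d; first by rewrite andbT (eqP eqd).
  have [/memT[-> _]|xT] := boolP (x \in T); first by rewrite andbT.
  rewrite andbF; apply/esym/negP => /AT.
  by rewrite !inE (negbTE xd) (negbTE xT).
- exists (symdiff S D); first exact: evenly_meets_symdiff.
  apply/setP => x; rewrite in_setI in_symdiff !inE.
  have [->|xd] := eqVneq x d.
    by rewrite andbT Dd; move: neqd; case: (d \in S); case: (d \in A).
  have [/memT[-> ->]|xT] := boolP (x \in T); first by rewrite andbT addbF.
  rewrite andbF; apply/esym/negP => /AT.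
  by rewrite !inE (negbTE xd) (negbTE xT).
Qed.

Lemma exists_evenly_meets_transversal F :
    (forall P, P \in F -> #|F| <= #|P|) ->
    (exists2 P : {set I}, P \in F & 1 < #|P|) ->
  exists2 S : {set I}, evenly_meets F S & forall P, P \in F -> P :&: S != set0.
Proof.
move=> leF [P1 P1F P1gt1].
have [T fT leT] := exists_free_cocard F.
have [S evS /setIidPr TS] := freeP _ _ fT T (subxx _).
have [/forall_inP hS|] := boolP [forall P : {set I} in F, P :&: S != set0].
  by exists S.
rewrite negb_forall => /existsP[B]; rewrite negb_imply negbK => /andP[BF /eqP BS].
have disj x : x \in B -> x \notin S.
  by move=> xB; apply/negP => xS; move/setP/(_ x): BS; rewrite !inE xB xS.
(* [B] avoids [S], hence also [T], and [#|~: T| <= #|F| <= #|B|] forces equality. *)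
have BT : B = ~: T.
  apply/eqP; rewrite eqEcard (leq_trans leT (leF _ BF)) andbT.
  apply/subsetP => x xB; rewrite inE; apply: contra (disj _ xB).
  exact: (subsetP TS).
have cardB : #|B| = #|F| by apply/eqP; rewrite eqn_leq leF // andbT BT.
have [t tT [P2 P2F tP2]] : exists2 t, t \in T & exists2 P : {set I}, P \in F & t \in P.
  have [/existsP[t /andP[tT /existsP[P /andP[PF tP]]]]|none] :=
    boolP [exists t, (t \in T) && [exists P : {set I}, (P \in F) && (t \in P)]].
    by exists t => //; exists P.
  (* If no member of [F] meets [T], all are contained in [B] and have at least its size. So [F] is
     reduced to [B], and [#|B| = #|F| <= 1] contradicts the choice of [P1]. *)
  have eqB P : P \in F -> P = B.
    move=> PF; apply/eqP; rewrite eqEcard cardB leF // andbT BT.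
    apply/subsetP => x xP; rewrite inE; apply: contra none => xT.
    by apply/existsP; exists x; rewrite xT; apply/existsP; exists P; rewrite PF.
  have FB : F \subset [set B] by apply/subsetP => P /eqB->; rewrite set11.
  move: P1gt1; rewrite (eqB _ P1F) cardB ltnNge.
  by move/subset_leq_card: FB; rewrite cards1 => ->.
(* [C] is the fundamental circuit of [t] with respect to the base [B]. *)
have [C evC CT] : exists2 C : {set I}, evenly_meets F C & C :&: T = [set t].
  by apply: (freeP _ _ fT); rewrite sub1set.
have memC x : x \in T -> (x \in C) = (x == t).
  by move=> xT; move/setP/(_ x): CT; rewrite !inE xT andbT.
have memB x : (x \in B) = (x \notin T) by rewrite BT inE.
have tC : t \in C by rewrite memC.
have BC_gt1 : 1 < #|B :&: C|.
  (* Otherwise [C] would be [[set t]] and would meet [P2] in a single color. Evenness at [B] then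
     raises the bound from one to two. *)
  have BC0 : B :&: C != set0.
    have := evenly_meetsP _ _ evC _ P2F; apply: contra => /eqP BC0.
    suff -> : P2 :&: C = [set t] by rewrite cards1.
    apply/setP => x; rewrite !inE; have [->|xt] := eqVneq x t.
      by rewrite tP2 tC.
    apply/negP => /andP[_ xC]; have [xT|xT] := boolP (x \in T).
      by move: xC; rewrite memC // (negbTE xt).
    by move/setP/(_ x): BC0; rewrite !inE memB xT xC.
  have := evenly_meetsP _ _ evC _ BF.
  by move: BC0; rewrite -card_gt0; case: #|B :&: C| => [|[|n]].
exists (symdiff S C); first exact: evenly_meets_symdiff.
move=> P PF; apply/negP => /eqP PS.
have disjP x : x \in P -> (x \in S) = (x \in C).
  by move=> xP; move/setP/(_ x): PS; rewrite in_setI in_symdiff xP inE;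
    case: (x \in S); case: (x \in C).
(* On a missed [P], the sets [S] and [C] agree. Inside [T], which [S] contains, this leaves only
   [t]; inside [B], which [S] avoids, it leaves only elements outside [C]. As [C] removes at least
   two elements of [B], such a [P] has fewer than [#|B| = #|F|] elements. *)
have sub : P \subset t |: (B :\: C).
  apply/subsetP => x xP; rewrite !inE memB; have := disjP _ xP.
  have [xT|xT] := boolP (x \in T).
    by rewrite (subsetP TS _ xT) memC // => <-.
  by rewrite -(negbTE (disj x _)) ?memB // => <-; rewrite disj ?memB ?xT ?orbT.
have := leq_trans (leF _ PF) (subset_leq_card sub).
rewrite -cardB -(cardsID C B) cardsU1 leqNgt => /negP; apply.
by rewrite ltn_add2r (leq_ltn_trans (leq_b1 _) BC_gt1).
Qed.

End EvenSets.

Lemma min_degree_le (G : graph) (v : vert G) : min_degree G <= degree v.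
Proof.
rewrite /min_degree; have : v \in index_enum (vert G) by rewrite mem_index_enum.
elim: (index_enum _) => // w s IHs; rewrite inE big_cons => /orP[/eqP->|/IHs].
  exact: geq_minl.
exact: leq_trans (geq_minr _ _).
Qed.

Section Coloring.

Variables (G : graph) (k : nat) (c : edge G -> 'I_k).
Hypothesis colc : edge_coloring c.

Lemma coloring_inj_at (v : vert G) :
  {in [set e | v \in ends e] &, injective c}.
Proof.
move=> e f; rewrite !inE => ve vf cef; apply/eqP/negPn/negP => nef.
apply: (colc (e := e) (f := f)) => //; rewrite /incident nef /=.
by apply/set0Pn; exists v; rewrite inE ve.
Qed.

Lemma card_palette (v : vert G) : #|palette c v| = degree v.
Proof. by rewrite card_in_imset //; exact: coloring_inj_at. Qed.

Definition color_subgraph (S : {set 'I_k}) : subgraph G :=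
  @Subgraph G [set: vert G] [set e | c e \in S] (fun e _ => subsetT (ends e)).

(** Edges at [v] have distinct colors, so they can be counted by color. This turns the parity and
    isolation conditions on [K] into conditions on palettes. *)
Lemma sub_degree_color_subgraph (S : {set 'I_k}) (v : vert G) :
  sub_degree (color_subgraph S) v = #|palette c v :&: S|.
Proof.
rewrite /sub_degree -(card_in_imset (f := c)); last first.
  move=> e f; rewrite !inE => /andP[_ ve] /andP[_ vf].
  by apply: (coloring_inj_at (v := v)); rewrite inE.
congr #|pred_of_set _|; apply/setP => a; rewrite in_setI.
apply/imsetP/andP => [[e]|[/imsetP[e]]].
  by rewrite !inE => /andP[eS ve] ->; split=> //; apply: imset_f; rewrite inE.
by rewrite inE => ve -> eS; exists e; rewrite ?inE ?ve ?eS.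
Qed.

End Coloring.

Theorem theorem2 (G : graph)
  (hDelta : 2 <= max_degree G)
  (hK : ~ exists K : subgraph G,
          [/\ spanning K, even_subgraph K & no_isolated_vertex K]) :
  min_degree G < palette_index G.
Proof.
rewrite ltnNge; apply/negP; rewrite /palette_index; case: ex_minnP => s.
move=> /boolp.asboolP[k [c [colc <-]]] _ les; apply: hK.
(* Palette sizes are vertex degrees: each is at least [min_degree G], hence at least the number of
   palettes, and a vertex of degree at least 2 provides the palette with two colors. *)
have [||S /evenly_meetsP evS trS] :=
  @exists_evenly_meets_transversal _ [set palette c v | v : vert G].
- move=> _ /imsetP[v _ ->]; rewrite card_palette //.
  exact: leq_trans les (min_degree_le v).
- have [/existsP[v v2]|] := boolP [exists v : vert G, 1 < degree v].
    by exists (palette c v); rewrite ?imset_f ?card_palette.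
  rewrite negb_exists => /forallP h; move: hDelta; rewrite ltnNge.
  suff -> : max_degree G <= 1 by [].
  by apply/bigmax_leqP => v _; rewrite leqNgt h.
exists (color_subgraph c S); split=> // v _; rewrite sub_degree_color_subgraph //.
  by apply: evS; rewrite imset_f.
by rewrite card_gt0 trS // imset_f.
Qed.
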